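(* Let $\mathbf{x}$ be a reversal-closed sequence. Then $\mathbf{x}$ is rich if and only if $r_{\mathbf{x}}(n+1)+r_{\mathbf{x}}(n) = \rho_{\mathbf{x}}(n+1)+1$ for all $n\ge 0$.
   Context: A factor of a sequence is a finite contiguous block. For a finite word $u=u(1)\cdots u(m)$, its reversal is $u^R=u(m)\cdots u(1)$; a palindrome is a word with $u=u^R$; $u$ and $v$ are reflectively equivalent if $v=u$ or $v=u^R$. The reflection complexity $r_{\mathbf{x}}(n)$ is the number of distinct length-$n$ factors of $\mathbf{x}$ up to reflective equivalence; $\rho_{\mathbf{x}}(n)$ is the number of distinct length-$n$ factors. A sequence is reversal-closed if for every factor $w$, $w^R$ is also a factor. A finite word $w$ has at most $|w|+1$ distinct palindromic factors (counting the empty word); a sequence is rich if each of its factors $w$ has exactly $|w|+1$ distinct palindromic factors. *)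

(* Defs.v *)
From mathcomp Require Import all_boot.
From mathcomp Require Import boolp.

Set Implicit Arguments.
Unset Strict Implicit.
Unset Printing Implicit Defensive.

Section Words.
Variable A : eqType.
Implicit Types (u v w : seq A) (x : nat -> A).

Definition palindrome u : bool := u == rev u.

Definition refl_equiv u v : bool := (v == u) || (v == rev u).

Lemma refl_equiv_equivalence : equivalence_rel refl_equiv.
Proof.
move=> u v w; split; first by rewrite /refl_equiv eqxx.
case/orP=> /eqP -> //.
by rewrite /refl_equiv revK orbC.
Qed.

Definition infixes w : seq (seq A) :=
  undup [seq take l (drop i w) | i <- iota 0 (size w).+1,
                                 l <- iota 0 (size w).+1].

Lemma mem_infixes u w : (u \in infixes w) = infix u w.
Proof.
rewrite mem_undup; apply/allpairsP/infixP => [[[i l] [_ _ ->]] | [s [t ->]]].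
  exists (take i w), (drop l (drop i w)) => /=.
  by rewrite !cat_take_drop.
exists (size s, size u); rewrite !mem_iota /= !add0n !ltnS !size_cat.
by rewrite leq_addr addnCA leq_addr drop_size_cat // take_size_cat.
Qed.

Definition pal_infixes w : seq (seq A) := [seq u <- infixes w | palindrome u].

Definition factor x w : Prop :=
  exists i, w = mkseq (fun j => x (i + j)) (size w).

Definition reversal_closed x : Prop := forall w, factor x w -> factor x (rev w).

(* [pal_infixes w] is duplicate-free and contains the empty word, so its size
   is the number of distinct palindromic factors, at most [(size w).+1]. *)
Definition rich x : Prop :=
  forall w, factor x w -> size (pal_infixes w) = (size w).+1.

End Words.

Section Complexity.
Variables (A : finType) (x : nat -> A).

Definition factors (n : nat) : {set n.-tuple A} :=
  [set w : n.-tuple A | `[< factor x w >]].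

Definition factor_complexity (n : nat) : nat := #|factors n|.

Definition reflection_complexity (n : nat) : nat :=
  #|equivalence_partition (fun u v : n.-tuple A => refl_equiv u v) (factors n)|.

End Complexity.

(* Main.v *)
(* Let [G_n] be the graph whose vertices are the reversal classes of factors of
   length [n] and whose edges are the classes of non-palindromic factors of
   length [n+1], each joining the classes of its prefix and its suffix.  As a
   non-palindromic class has two elements and a palindromic one has one, the
   identity at [n] says that [G_n] has one more vertex than edges.  Reading [x]
   from left to right walks through [G_n]; the first visit to each vertex but the
   initial one uses a new edge, so the identity holds iff every new edge leads to
   a new vertex.  This in turn is equivalent, over all [n], to every block that
   starts and ends in a class of words of length [n], with no other visit to the
   class, being a palindrome; and the latter is equivalent to the longest
   palindromic suffix of every factor occurring only once in it, i.e. richness. *)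
Require Import Defs.
From mathcomp Require Import all_boot.
From mathcomp Require Import boolp zify.

Set Implicit Arguments.
Unset Strict Implicit.
Unset Printing Implicit Defensive.

(** * Blocks of a sequence and their reversal classes *)

Section Blocks.
Variable A : eqType.
Implicit Types (x : nat -> A) (i j k l m n : nat).

Definition block x i n : seq A := mkseq (fun j => x (i + j)) n.

Definition refl_eq x n i j : bool := refl_equiv (block x i n) (block x j n).

Lemma size_block x i n : size (block x i n) = n.
Proof. exact: size_mkseq. Qed.

Lemma factor_block x i n : factor x (block x i n).
Proof. by exists i; rewrite size_block. Qed.

Lemma rev_block x i n : rev (block x i n) = mkseq (fun j => x (i + (n - j.+1))) n.
Proof.
apply: (@eq_from_nth _ (x 0)); first by rewrite size_rev !size_mkseq.
move=> t; rewrite size_rev size_mkseq => lt_tn.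
rewrite nth_rev size_mkseq // !nth_mkseq //; lia.
Qed.

Lemma eq_mkseqP (f g : nat -> A) n :
  mkseq f n = mkseq g n <-> (forall t, t < n -> f t = g t).
Proof.
split=> [eq_fg t lt_tn | eq_fg].
  by rewrite -(nth_mkseq (f 0) f lt_tn) eq_fg nth_mkseq.
by apply/eq_in_map => t; rewrite mem_iota => /andP[_ /eq_fg].
Qed.

Lemma eq_blockP x i j n :
  block x i n = block x j n <-> (forall t, t < n -> x (i + t) = x (j + t)).
Proof. exact: eq_mkseqP. Qed.

Lemma eq_rev_blockP x i j n :
  block x i n = rev (block x j n) <->
  (forall t, t < n -> x (i + t) = x (j + (n - t.+1))).
Proof. by rewrite rev_block; apply: eq_mkseqP. Qed.

Lemma palindrome_blockP x i n :
  palindrome (block x i n) <->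
  (forall t, t < n -> x (i + t) = x (i + (n - t.+1))).
Proof. by rewrite -eq_rev_blockP; split=> /eqP. Qed.

Lemma refl_eqP x n i j :
  refl_eq x n i j <->
  (forall t, t < n -> x (i + t) = x (j + t)) \/
  (forall t, t < n -> x (i + t) = x (j + (n - t.+1))).
Proof.
rewrite -eq_blockP -eq_rev_blockP /refl_eq /refl_equiv; split.
  by case/orP=> /eqP ->; [left | right; rewrite revK].
by case=> ->; rewrite ?revK eqxx ?orbT.
Qed.

(** Equality matches prefix with prefix and suffix with suffix, whereas reversal swaps the two ends
    of an edge. *)
Lemma refl_eq_ends {x n i j} : refl_eq x n.+1 i j ->
  (refl_eq x n i j /\ refl_eq x n i.+1 j.+1) \/
  (refl_eq x n i j.+1 /\ refl_eq x n i.+1 j).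
Proof.
case/refl_eqP => E; [left | right]; split; apply/refl_eqP; [left|left|right|right] => t lt_tn.
- by apply: E; lia.
- by have := E t.+1; rewrite !addnS !addSn; apply; lia.
- by rewrite E; [congr x|]; lia.
- by rewrite addSn -addnS E; [congr x|]; lia.
Qed.

Lemma refl_eq_palindrome {x n i} : palindrome (block x i n.+1) -> refl_eq x n i i.+1.
Proof.
move/palindrome_blockP=> E; apply/refl_eqP; right=> t lt_tn.
rewrite E; [congr x|]; lia.
Qed.

(** * First visits to vertices and edges *)

Definition new_block x n i : bool := all (fun j => ~~ refl_eq x n j i) (iota 0 i).

Lemma new_blockP x n i :
  reflect (forall j, j < i -> ~~ refl_eq x n j i) (new_block x n i).
Proof.
apply: (iffP allP) => new j; last by rewrite mem_iota => /andP[_ /new].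
by move=> lt_ji; apply: new; rewrite mem_iota.
Qed.

Definition new_edge x n i : bool :=
  new_block x n.+1 i && ~~ palindrome (block x i n.+1).

(** An earlier use of the edge would already have visited its endpoint, and a palindromic word leads
    back to the class it leaves. *)
Lemma new_block_edge x n i : new_block x n i.+1 -> new_edge x n i.
Proof.
move/new_blockP=> new; apply/andP; split.
  apply/new_blockP => j lt_ji; apply/negP => /refl_eq_ends[] [].
    by move=> _; apply/negP/new; lia.
  by move=> E _; move: E; apply/negP/new; lia.
by apply/negP => /refl_eq_palindrome; apply/negP/new.
Qed.

Definition shift x s : nat -> A := fun j => x (s + j).

Lemma block_shift x s i n : block (shift x s) i n = block x (s + i) n.
Proof. by apply: eq_mkseq => t; rewrite /shift addnA. Qed.

Lemma refl_eq_shift x s n i j :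
  refl_eq (shift x s) n i j = refl_eq x n (s + i) (s + j).
Proof. by rewrite /refl_eq !block_shift. Qed.

(** * Palindromic returns *)

Definition palindromic_returns x : Prop := forall n i k,
  i < k -> refl_eq x n i k -> (forall j, i < j < k -> ~~ refl_eq x n j k) ->
  palindrome (block x i (k - i + n)).

Lemma max_below (P : pred nat) i k :
  i < k -> P i -> exists j, [/\ i <= j < k, P j & forall l, j < l < k -> ~~ P l].
Proof.
move=> lt_ik Pi.
have ex : exists j, (j < k) && P j by exists i; rewrite lt_ik.
have ub : forall j, (j < k) && P j -> j <= k by move=> j /andP[/ltnW].
case: (ex_maxnP ex ub) => j /andP[lt_jk Pj] maxj; exists j; split=> //.
  by rewrite lt_jk andbT; apply: maxj; rewrite lt_ik.
move=> l /andP[lt_jl lt_lk]; apply/negP => Pl.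
by have := maxj l; rewrite lt_lk Pl leqNgt lt_jl => /(_ isT).
Qed.

(** If the vertex reached is old, its last visit [j] starts a palindromic return. Reversal carries
    the edge at [i] to the one at [j]: an earlier use if [j < i], a palindrome if [j = i]. *)
Lemma returns_new_block x n i :
  palindromic_returns x -> new_edge x n i -> new_block x n i.+1.
Proof.
move=> ret /andP[/new_blockP new npal]; apply/new_blockP => j0 lt_j0; apply/negP => Rj0.
have [j [/andP[_ lt_ji] Rj maxj]] :=
  @max_below (fun j => refl_eq x n j i.+1) j0 i.+1 lt_j0 Rj0.
have /palindrome_blockP pal := ret _ _ _ lt_ji Rj maxj.
have : refl_eq x n.+1 j i.
  by apply/refl_eqP; right=> t lt_tn; rewrite pal; [congr x|]; lia.
have [lt_j|eq_ji] : j < i \/ j = i by lia.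
  by apply/negP/new.
case/negP: npal; apply/palindrome_blockP => t lt_tn.
by rewrite -eq_ji pal; [congr x|]; lia.
Qed.

(* Shifting [x] to start at [i] makes the block at [i] the root of the
   exploration, so the hypothesis applied at the return time [k] forces the
   last edge of the return to be the first one; then lengthen the blocks. *)
Lemma new_block_returns x :
  (forall s n i, new_edge (shift x s) n i ->
                 new_block (shift x s) n i.+1) ->
  palindromic_returns x.
Proof.
move=> disc n i k; move def_d: (k - i) => d.
elim: d n k def_d => [|d IHd] n k def_d lt_ik Rik inner; first lia.
have eq_k : k = i + d.+1 by lia.
have oldV : ~~ new_block (shift x i) n d.+1.
  by apply/negP => /new_blockP /(_ 0 isT); rewrite refl_eq_shift addn0 -eq_k Rik.
have : ~~ new_edge (shift x i) n d by apply: contra oldV; apply: disc.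
have only_i j : i <= j < k -> refl_eq x n j k -> j = i.
  move=> lt_j Rj; case: (ltngtP i j) => [lt_ij | | //]; last lia.
  by move: (inner j); rewrite Rj lt_ij; case/andP: lt_j => _ ->; move/(_ isT).
(* If the last word of length [n.+1] is a palindrome, it leads from the class to itself, so the
   return is that word alone. *)
rewrite negb_and negbK => /orP[/new_blockP old | pal]; last first.
  have := refl_eq_palindrome pal; rewrite refl_eq_shift => R.
  have E : i + d = i by apply: only_i; [lia | rewrite eq_k].
  by rewrite block_shift E in pal; have -> : d.+1 + n = n.+1 by lia.
have [j lt_jd Rj] : exists2 j, j < d & refl_eq x n.+1 (i + j) (i + d).
  apply: contrapT => no; apply: old => j lt_jd; apply/negP => R.
  by apply: no; exists j; rewrite -?refl_eq_shift.
have eq_j : i + j = i.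
  case: (refl_eq_ends Rj) => -[R1 R2]; last first.
    by apply: only_i; [lia | rewrite eq_k addnS].
  suff: (i + j).+1 = i by lia.
  by apply: only_i; [lia | rewrite eq_k addnS].
rewrite eq_j in Rj.
(* The same word is a return of blocks of length [n.+1] from [i] to [i + d], a distance shorter by
   one. *)
have -> : d.+1 + n = d + n.+1 by lia.
apply: (IHd _ (i + d)) => //; [lia | lia | move=> l lt_l].
apply/negP => /refl_eq_ends[] [R1 R2].
  suff: l.+1 = i by lia.
  by apply: only_i; [lia | rewrite eq_k addnS].
suff: l = i by lia.
by apply: only_i; [lia | rewrite eq_k addnS].
Qed.

(** * Longest palindromic suffixes and richness *)

Definition unioccurrent_suffix x : Prop := forall i l k,
  i <= l < k ->
  palindrome (block x l (k - l)) ->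
  (forall j, i <= j < l -> ~~ palindrome (block x j (k - j))) ->
  forall j, i <= j < l -> block x j (k - l) <> block x l (k - l).

Lemma last_palindrome_start x i k : i < k -> exists l,
  [/\ i <= l < k, palindrome (block x l (k - l)) &
      forall j, i <= j < l -> ~~ palindrome (block x j (k - j))].
Proof.
move=> lt_ik.
have ex : exists l, (i <= l) && palindrome (block x l (k - l)).
  exists k.-1; apply/andP; split; first lia.
  have -> : k - k.-1 = 1 by lia.
  exact: eqxx.
case: (ex_minnP ex) => l /andP[le_il pal] minl; exists l; split=> //.
  have := minl k.-1; have -> : k - k.-1 = 1 by lia.
  have -> : palindrome (block x k.-1 1) by exact: eqxx.
  lia.
move=> j /andP[le_ij lt_jl]; apply/negP => palj.
by have := minl j; rewrite le_ij palj leqNgt lt_jl => /(_ isT).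
Qed.

(** The longest palindromic suffix of the return, starting at [l], is all of it: otherwise it recurs
    inside the return or yields a forbidden visit at [l]. *)
Lemma unioccurrent_returns x : unioccurrent_suffix x -> palindromic_returns x.
Proof.
move=> uni n i k lt_ik Rik inner.
have [l [lt_l pal minl]] := @last_palindrome_start x i (k + n) ltac:(lia).
have eq_len : k + n - i = k - i + n by lia.
have /palindrome_blockP palE := pal.
(* For [l <= k] the palindrome ends with the block at [k], hence starts with its reversal. *)
have [le_lk | lt_kl] := leqP l k.
  have Rlk : refl_eq x n l k.
    by apply/refl_eqP; right=> t lt_tn; rewrite palE; [congr x|]; lia.
  have [eq_li | [eq_lk | lt_ilk]] : l = i \/ l = k \/ i < l < k by lia.
  - by rewrite -eq_len -eq_li.
  - exfalso; apply: (uni _ _ _ lt_l pal minl i); first lia.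
    rewrite eq_lk; apply/eq_blockP => t lt_t.
    case/refl_eqP: Rik => -> //; try lia.
    by have := palE t; rewrite eq_lk => ->; [congr x|]; lia.
  - by have := inner _ lt_ilk; rewrite Rlk.
(* For [k < l] the suffix lies inside the block at [k], so it also occurs in the block at [i],
   translated or reflected. *)
exfalso; case/refl_eqP: Rik => Rik.
  apply: (uni _ _ _ lt_l pal minl (l - (k - i))); first lia.
  apply/eq_blockP => t lt_t.
  have -> : l - (k - i) + t = i + (l - k + t) by lia.
  by rewrite Rik; [congr x|]; lia.
apply: (uni _ _ _ lt_l pal minl i); first lia.
apply/eq_blockP => t lt_t.
by rewrite palE // Rik; [congr x|]; lia.
Qed.

(** The return from the nearest earlier visit to the class of the suffix is a palindrome, hence a
    longer palindromic suffix. *)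
Lemma returns_unioccurrent x : palindromic_returns x -> unioccurrent_suffix x.
Proof.
move=> ret i l k lt_l pal minl j0 lt_j0 eq_j0.
have Rj0 : refl_eq x (k - l) j0 l by rewrite /refl_eq eq_j0 /refl_equiv eqxx.
have [j [lt_j Rj maxj]] :=
  @max_below (fun j => refl_eq x (k - l) j l) j0 l ltac:(lia) Rj0.
have /negP[] : ~~ palindrome (block x j (k - j)) by apply: minl; lia.
have -> : k - j = l - j + (k - l) by lia.
by apply: ret => //; lia.
Qed.

(** A palindromic suffix shorter than [s] is also a prefix of [s], so it occurs in [w]; only [s] can
    be new. *)
Lemma pal_infixes_rcons (w : seq A) a l :
  let s := drop l (rcons w a) in
  palindrome s -> l <= size w ->
  (forall j, j < l -> ~~ palindrome (drop j (rcons w a))) ->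
  size (pal_infixes (rcons w a)) = size (pal_infixes w) + ~~ infix s w.
Proof.
move=> s pal_s le_l minl.
have uniq_pal v : uniq (pal_infixes v).
  by rewrite filter_uniq ?undup_uniq.
have mem_pal u v : (u \in pal_infixes v) = palindrome u && infix u v.
  by rewrite mem_filter mem_infixes.
have suffix_s u : palindrome u -> suffix u (rcons w a) -> u = s \/ infix u w.
  move=> pal_u; rewrite suffixE => /eqP eq_u.
  set j := size (rcons w a) - size u in eq_u.
  have [lt_jl | le_lj] := ltnP j l; first by have := minl j lt_jl; rewrite eq_u pal_u.
  have [eq_lj | ne_lj] := eqVneq l j; first by left; rewrite -eq_u -eq_lj.
  right; have : suffix u s.
    rewrite -eq_u -(subnK le_lj) -drop_drop.
    by rewrite -[X in suffix _ X](cat_take_drop (j - l)) suffix_suffix.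
  rewrite -prefix_rev -(eqP pal_s : s = rev s) -(eqP pal_u : u = rev u).
  rewrite prefixE {1}/s drop_rcons // -cats1 takel_cat; last first.
    by have := congr1 size eq_u; rewrite !size_drop size_rcons; lia.
  move/eqP=> <-; rewrite -[X in infix _ X](cat_take_drop l) infix_catl //.
  by rewrite -[X in infix _ X](cat_take_drop (size u)) infix_catr ?infix_refl.
have infix_s : infix s (rcons w a).
  by rewrite -[X in infix _ X](cat_take_drop l) infix_catl ?infix_refl.
case: (boolP (infix s w)) => [in_s | nin_s].
  rewrite addn0; apply/eqP; rewrite -uniq_size_uniq // => u.
  rewrite !mem_pal; apply: andb_id2l => pal_u.
  rewrite infix_rconsl; case: (boolP (suffix _ _)) => // suf_u.
  by case: (suffix_s u pal_u suf_u) => [-> | ->].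
rewrite addn1; apply/esym/eqP; rewrite -[X in X == _]/(size (s :: _)).
rewrite -uniq_size_uniq //=.
  by rewrite uniq_pal mem_pal negb_and nin_s orbT.
move=> u; rewrite inE !mem_pal infix_rconsl.
have [-> | ne_us] := eqVneq u s; first by rewrite pal_s -infix_rconsl infix_s.
apply: andb_id2l => pal_u; case: (boolP (suffix _ _)) => // suf_u.
by case: (suffix_s u pal_u suf_u) => [eq_us | ->] //; rewrite eq_us eqxx in ne_us.
Qed.

Lemma drop_block x i n l : drop l (block x i n) = block x (i + l) (n - l).
Proof.
rewrite /block /mkseq -map_drop drop_iota -[l in iota l]addn0 iotaDl -map_comp.
by apply: eq_map => t /=; rewrite addnA.
Qed.

Lemma infix_blockP x i n s : infix s (block x i n) <->
  exists j, [/\ i <= j, j + size s <= i + n & s = block x j (size s)].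
Proof.
split=> [/infixP[p [q eq_b]] | [j [le_ij le_n ->]]]; last first.
  apply/infixP; exists (block x i (j - i)), (block x (j + size s) (i + n - (j + size s))).
  have {1}-> : n = (j - i) + (size s + (i + n - (j + size s))) by lia.
  rewrite /block /mkseq !iotaD !map_cat !add0n; congr (_ ++ (_ ++ _)).
    rewrite -[X in iota X _]addn0 iotaDl -map_comp; apply: eq_map => t /=.
    by congr x; lia.
  rewrite -[X in iota X _]addn0 iotaDl -map_comp; apply: eq_map => t /=.
  by congr x; lia.
have := congr1 size eq_b; rewrite size_block !size_cat => eq_n.
exists (i + size p); split; [lia | lia |].
have := congr1 (take (size s) \o drop (size p)) eq_b.
rewrite /= drop_size_cat // take_size_cat // drop_block => eq_s.
rewrite -{1}eq_s /block /mkseq -map_take take_iota; congr (map _ (iota _ _)); lia.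
Qed.

Lemma size_pal_infixes_block x i l m :
  i <= l <= i + m -> palindrome (block x l (i + m.+1 - l)) ->
  (forall j, i <= j < l -> ~~ palindrome (block x j (i + m.+1 - j))) ->
  size (pal_infixes (block x i m.+1)) =
  size (pal_infixes (block x i m)) + ~~ infix (block x l (i + m.+1 - l)) (block x i m).
Proof.
move=> lt_l pal minl.
have dropE j : i <= j -> drop (j - i) (block x i m.+1) = block x j (i + m.+1 - j).
  by move=> le_ij; rewrite drop_block; congr (block x); lia.
have blockS : block x i m.+1 = rcons (block x i m) (x (i + m)) by exact: mkseqS.
rewrite blockS in dropE *.
rewrite (@pal_infixes_rcons _ _ (l - i)) ?dropE ?size_block //; try lia.
move=> j lt_j; have -> : j = i + j - i by lia.
by rewrite dropE; [apply: minl|]; lia.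
Qed.

(** Starting from the empty word, each added letter contributes one palindrome exactly when the
    longest palindromic suffix is new. *)
Lemma rich_unioccurrent x : rich x <-> unioccurrent_suffix x.
Proof.
split=> [rich_x i l k lt_l pal minl j lt_j eq_j | uni w [i ->]].
  have [m eq_k] : exists m, k = i + m.+1 by exists (k - i).-1; lia.
  subst k; have := @size_pal_infixes_block x i l m ltac:(lia) pal minl.
  rewrite !(rich_x _ (factor_block _ _ _)) !size_block.
  suff -> : infix (block x l (i + m.+1 - l)) (block x i m) by lia.
  apply/infix_blockP; exists j; rewrite size_block; split=> //; lia.
rewrite size_block; elim: (size w) => [|m IHm]; first by [].
have [l [lt_l pal minl]] := @last_palindrome_start x i (i + m.+1) ltac:(lia).
rewrite (@size_pal_infixes_block x i l) ?IHm //; last lia.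
suff -> : ~~ infix (block x l (i + m.+1 - l)) (block x i m) by rewrite addn1.
apply/negP => /infix_blockP[j]; rewrite size_block => -[le_ij le_j eq_j].
apply: (uni _ _ _ lt_l pal minl j); [lia | by rewrite -eq_j].
Qed.

End Blocks.

(** * Counting classes by first occurrences *)

Section FirstOccurrences.
Variables (T : finType) (R : rel T) (D : {set T}) (f : nat -> T) (N : nat).
Hypothesis eqvR : equivalence_rel R.
Hypothesis fD : forall i, f i \in D.
Hypothesis fN : forall u, u \in D -> exists2 i, i < N & f i = u.

(** Has the shape of [new_block], so that the two are convertible when [f] reads off blocks. *)
Let first : pred 'I_N := fun i => all (fun j => ~~ R (f j) (f i)) (iota 0 i).
Let class u := [set v in D | R u v].

Let class_eq u v : u \in D -> v \in D -> R u v -> class u = class v.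
Proof.
move=> uD vD Ruv; apply/setP => w; rewrite !inE; congr (_ && _).
by case: (eqvR u v w) => _ ->.
Qed.

Lemma equivalence_partition_first :
  equivalence_partition R D = [set class (f i) | i : 'I_N in first].
Proof.
apply/setP => B; apply/imsetP/imsetP => [[u uD ->] | [i _ ->]]; last by exists (f i).
have [j lt_jN eq_u] := fN uD.
have ex : exists i, (i < N) && R (f i) u.
  by exists j; rewrite lt_jN eq_u; case: (eqvR u u u).
case: (ex_minnP ex) => i /andP[lt_iN Ri] mini.
exists (Ordinal lt_iN); last by apply/esym/class_eq.
rewrite unfold_in; apply/allP => k; rewrite mem_iota => /= lt_ki; apply/negP => Rk.
have := mini k; rewrite (ltn_trans lt_ki lt_iN) leqNgt lt_ki => H; suff: false by []; apply: H.
by case: (eqvR (f k) (f i) u) => _ /(_ Rk) ->.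
Qed.

Let class_inj : {in first &, injective (fun i : 'I_N => class (f i))}.
Proof.
move=> i j; rewrite !unfold_in => /allP fi /allP fj /= eq_ij.
have Rij : R (f i) (f j).
  have : f j \in class (f j) by rewrite inE fD; case: (eqvR (f j) (f j) (f j)).
  by rewrite -eq_ij inE => /andP[].
have Rji : R (f j) (f i).
  case: (eqvR (f i) (f j) (f i)) => rfl /(_ Rij) <-; exact: rfl.
apply/val_inj => /=; case: (ltngtP i j) => // [lt|lt].
  by have := fj i; rewrite mem_iota lt Rij => /(_ isT).
by have := fi j; rewrite mem_iota lt Rji => /(_ isT).
Qed.

Lemma card_equivalence_partition_first :
  #|equivalence_partition R D| = #|first|.
Proof. by rewrite equivalence_partition_first card_in_imset. Qed.

Lemma card_first : #|D| = \sum_(i : 'I_N | first i) #|class (f i)|.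
Proof.
have eqvRD : {in D & &, equivalence_rel R} by move=> u v w _ _ _; apply: eqvR.
rewrite (card_partition (equivalence_partitionP eqvRD)).
by rewrite equivalence_partition_first big_imset.
Qed.

End FirstOccurrences.

(** * The complexity identity as a condition on new edges *)

Section Complexities.
Variables (A : finType) (x : nat -> A).
Hypothesis closed_x : reversal_closed x.

Let btuple n i : n.-tuple A := [tuple of block x i n].

Let mem_factors n (u : n.-tuple A) : u \in factors x n <-> exists i, u = btuple n i.
Proof.
rewrite inE; split=> [/asboolP[i eq_u] | [i ->]].
  by exists i; apply: val_inj; rewrite /= eq_u size_tuple.
by apply/asboolP/factor_block.
Qed.

Lemma factors_bound n : exists N, forall u, u \in factors x n ->
  exists2 i, i < N & btuple n i = u.
Proof.
have /boolp.choice[g gP] (u : n.-tuple A) : exists i, u \in factors x n -> btuple n i = u.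
  have [/mem_factors[i ->] | _] := boolP (u \in factors x n); last by exists 0.
  by exists i.
exists (\max_u g u).+1 => u uF; exists (g u); last exact: gP.
by rewrite ltnS leq_bigmax.
Qed.

Let refl_equiv_tuple n : equivalence_rel (fun u v : n.-tuple A => refl_equiv u v).
Proof. by move=> u v w; apply: refl_equiv_equivalence. Qed.

Lemma reflection_complexity_sum n N :
  (forall u, u \in factors x n -> exists2 i, i < N & btuple n i = u) ->
  reflection_complexity x n = \sum_(i < N) new_block x n i.
Proof.
move=> boundN; rewrite /reflection_complexity.
have mem_b i : btuple n i \in factors x n by apply/mem_factors; exists i.
rewrite (card_equivalence_partition_first (@refl_equiv_tuple n) mem_b boundN).
by rewrite -sum1_card big_mkcond; apply: eq_bigr.
Qed.

(** Reversal closure keeps both [u] and [rev u] among the factors, so a class counts once, and once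
    more if [u] is not a palindrome. *)
Lemma factor_complexity_sum n N :
  (forall u, u \in factors x n -> exists2 i, i < N & btuple n i = u) ->
  factor_complexity x n = \sum_(i < N) new_block x n i +
    \sum_(i < N) (new_block x n i && ~~ palindrome (block x i n)).
Proof.
move=> boundN; rewrite /factor_complexity.
have mem_b i : btuple n i \in factors x n by apply/mem_factors; exists i.
rewrite (card_first (@refl_equiv_tuple n) mem_b boundN).
rewrite -big_split big_mkcond; apply: eq_bigr => i _ /=.
rewrite -/(new_block x n i); case: (new_block x n i) => //=.
have -> : [set v in factors x n | refl_equiv (btuple n i) v] =
          [set btuple n i; [tuple of rev (btuple n i)]].
  apply/setP => v; rewrite !inE /refl_equiv -!val_eqE /= andbC.
  apply: andb_idr => /orP[] /eqP ->; apply/asboolP; first exact: factor_block.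
  exact/closed_x/factor_block.
by rewrite cards2 -val_eqE.
Qed.

Lemma complexity_identity_new_block n :
  reflection_complexity x n.+1 + reflection_complexity x n
    = factor_complexity x n.+1 + 1 <->
  (forall i, new_edge x n i -> new_block x n i.+1).
Proof.
have [N0 bound0] := factors_bound n; have [N1 bound1] := factors_bound n.+1.
have identity N : N0 <= N -> N1 <= N ->
  (reflection_complexity x n.+1 + reflection_complexity x n
    == factor_complexity x n.+1 + 1) =
  [forall i : 'I_N, new_edge x n i ==> new_block x n i.+1].
  move=> le0 le1.
  (* Vertices need one more index than edges, as the edge at [i] ends at [i.+1]; index 0 yields the
     constant 1. *)
  rewrite (@reflection_complexity_sum n N.+1); last first.
    by move=> u /bound0[i lt_i]; exists i => //; lia.
  have bN u : u \in factors x n.+1 -> exists2 i, i < N & btuple n.+1 i = u.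
    by move=> /bound1[i lt_i]; exists i => //; lia.
  rewrite (reflection_complexity_sum bN) (factor_complexity_sum bN) big_ord_recl.
  set E := \sum_(i < N) (_ && _); set V := \sum_(i < N) new_block x n _.
  have -> p : (p + (1 + V) == p + E + 1) = (V == E) by lia.
  (* The terms of [V] are bounded by those of [E], so equal sums mean equality at every index. *)
  have step (i : 'I_N) : true -> new_block x n (lift ord0 i) <= new_edge x n i
      ?= iff (new_edge x n i ==> new_block x n i.+1).
    rewrite lift0 => _; have := @new_block_edge _ x n i.
    by case: (new_block _ _ _) (new_edge _ _ _) => [] [] // /(_ isT).
  by case: (leqif_sum step).
split=> [/eqP id_n i | disc].
  (* The bound must also exceed the index [i] under test. *)
  move: id_n; rewrite (identity (maxn N0 (maxn N1 i.+1))); try lia.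
  have lt_i : i < maxn N0 (maxn N1 i.+1) by lia.
  by move=> /forallP /(_ (Ordinal lt_i)) /implyP.
apply/eqP; rewrite (identity (maxn N0 N1)); try lia.
by apply/forallP => i; apply/implyP/disc.
Qed.

End Complexities.

(** * Recurrence and the equivalence *)

(* A prefix of length [L] contains [u] at distance at least [s] from its end, so
   its reversal contains [rev u] at a position at least [s]. *)
Lemma reversal_closed_recurrent (A : eqType) (x : nat -> A) s w :
  reversal_closed x -> factor x w -> factor (shift x s) w.
Proof.
have late_rev u : reversal_closed x -> factor x u -> factor (shift x s) (rev u).
  move=> closed_x [i]; move: (size u) => m ->; pose L := s + i + m.
  have [k] := closed_x _ (factor_block x 0 L).
  rewrite size_rev size_block => /esym/eq_rev_blockP eq_k.
  exists k; rewrite size_rev size_mkseq -/(block (shift x s) _ _) block_shift.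
  apply/esym/eq_rev_blockP => t lt_t.
  have -> : s + k + t = k + (s + t) by lia.
  by rewrite eq_k; [congr x|]; lia.
move=> closed_x /closed_x fw; rewrite -[w]revK; exact: late_rev.
Qed.

Lemma factor_shift (A : eqType) (x : nat -> A) s w :
  reversal_closed x -> factor (shift x s) w <-> factor x w.
Proof.
move=> closed_x; split; last exact: reversal_closed_recurrent.
by case=> i ->; rewrite -/(block _ _ _) block_shift; apply: factor_block.
Qed.

Theorem theorem7p1 (A : finType) (x : nat -> A) (hx : reversal_closed x) :
  rich x <->
  (forall n : nat,
     reflection_complexity x n.+1 + reflection_complexity x n
     = factor_complexity x n.+1 + 1).
Proof.
rewrite rich_unioccurrent; split=> [/unioccurrent_returns ret n | id_x].
  by apply/(complexity_identity_new_block hx n) => i; apply: returns_new_block.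
apply/returns_unioccurrent/new_block_returns => s n.
(* By recurrence every shift has the same factors as [x], so it inherits both closure and the
   identity. *)
have hs : reversal_closed (shift x s).
  by move=> w; rewrite !factor_shift //; apply: hx.
have factorsE m : factors (shift x s) m = factors x m.
  by apply/setP => u; rewrite !inE; apply: asbool_equiv_eq; apply: factor_shift.
apply/(complexity_identity_new_block hs n).
by rewrite /reflection_complexity /factor_complexity !factorsE; apply: id_x.
Qed.
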